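(* Let $\kappa=[2\ell]$ for some $\ell\in\mathbb Z$, let $t=F+\check E+\kappa K^{-1}\in\mathbf U$, and define for $a\ge 0$ $$\dot t^{(2a)}=\frac{t}{[2a]!}\prod_{j=-a+1}^{a-1}\bigl(t-[2j]\bigr),\qquad \dot t^{(2a+1)}=\frac{1}{[2a+1]!}\prod_{j=-a}^{a}\bigl(t-[2j]\bigr)$$ (so $\dot t^{(0)}=1$, $\dot t^{(1)}=t$). Then for every $m\ge 1$, in $\mathbf U$, $$\dot t^{(2m)}=\sum_{b=0}^{2m}\sum_{a=0}^{b}\sum_{c\ge 0} q^{\binom{2c}{2}-b(2m-b-2c)-a(b-a)}\,p^{(2m-b-2c)}(\kappa)\;\check E^{(a)}\begin{bmatrix}h;1-m\\ c\end{bmatrix}K^{b-2m+2c}F^{(b-a)},$$ $$\dot t^{(2m-1)}=\sum_{b=0}^{2m-1}\sum_{a=0}^{b}\sum_{c\ge 0} q^{\binom{2c}{2}+2c-b(2m-b-2c-1)-a(b-a)}\,p^{(2m-b-2c-1)}(\kappa)\;\check E^{(a)}\begin{bmatrix}h;1-m\\ c\end{bmatrix}K^{b-2m+2c+1}F^{(b-a)}.$$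
   Context: $q$ is an indeterminate, $[n]=\frac{q^n-q^{-n}}{q-q^{-1}}$ for $n\in\mathbb Z$, $[n]!=[1][2]\cdots[n]$, $[0]!=1$. $\mathbf U$ is the $\mathbb Q(q)$-algebra generated by $E,F,K,K^{-1}$ with relations $KK^{-1}=K^{-1}K=1$, $EF-FE=\frac{K-K^{-1}}{q-q^{-1}}$, $KE=q^2EK$, $KF=q^{-2}FK$. Put $\check E=q^{-1}EK^{-1}$, and $\check E^{(n)}=\check E^n/[n]!$, $F^{(n)}=F^n/[n]!$ for $n\ge 0$. For $a\in\mathbb Z$, $n\in\mathbb N$: $\begin{bmatrix}h;a\\ n\end{bmatrix}=\prod_{i=1}^{n}\frac{q^{4a+4i-4}K^{-2}-1}{q^{4i}-1}$ (equal to $1$ for $n=0$). The polynomials $p_n(x)\in\mathbb Q(q)[x]$ are defined by $p_0=1$, $p_n=0$ for $n<0$, and $p_{n+1}=x\,p_n+q^{1-2n}[n][n-1]\,p_{n-1}$ for $n\ge 0$; set $p^{(n)}(x)=p_n(x)/[n]!$ for $n\ge0$ and $p^{(n)}=0$ for $n<0$ (so the sums over $c$ are finite). *)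

(* Defs.v *)
From HB Require Import structures.
From mathcomp Require Import all_boot all_order all_algebra.
Set Implicit Arguments. Unset Strict Implicit. Unset Printing Implicit Defensive.
Import Order.TTheory GRing.Theory Num.Theory.
Local Open Scope ring_scope.

Definition Qq : fieldType := {fraction {poly rat}}.
Definition q : Qq := tofrac ('X : {poly rat}).

Definition qint (n : int) : Qq := (q ^ n - q ^ (- n)) / (q - q^-1).

Definition qfact (n : nat) : Qq := \prod_(i < n) qint (i.+1)%:Z.

(* pair (p_n, p_{n+1}) with p_0 = 1, p_{-1} = 0,
   p_{n+1} = x p_n + q^{1-2n} [n][n-1] p_{n-1} *)
Fixpoint ppair (n : nat) : {poly Qq} * {poly Qq} :=
  match n with
  | 0 => (1, 'X)   (* p_1 = x p_0 + q^1 [0][-1] p_{-1} = x *)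
  | k.+1 => let (a, b) := ppair k in
            (b, 'X * b + (q ^ (1 - 2 * (k.+1)%:Z) * qint (k.+1)%:Z * qint k%:Z) *: a)
  end.
Definition pn (n : nat) : {poly Qq} := (ppair n).1.

Definition p_div (n : int) : {poly Qq} :=
  match n with
  | Posz k => (qfact k)^-1 *: pn k
  | Negz _ => 0
  end.

Section InU.
Variable A : algType Qq.
Variables (E F K Ki : A).  (* Ki plays the role of K^{-1} *)

Definition Kpow (z : int) : A :=
  match z with
  | Posz n => K ^+ n
  | Negz n => Ki ^+ n.+1
  end.

Definition Echeck : A := q^-1 *: (E * Ki).
Definition Echeck_div (n : nat) : A := (qfact n)^-1 *: Echeck ^+ n.
Definition F_div (n : nat) : A := (qfact n)^-1 *: F ^+ n.

Definition hbin (a : int) (n : nat) : A :=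
  \prod_(i < n)
     ((q ^+ (4 * i.+1) - 1)^-1 *: (q ^ (4 * a + 4 * (i.+1)%:Z - 4) *: (Ki ^+ 2) - 1)).

Definition tgen (kappa : Qq) : A := F + Echeck + kappa *: Ki.

Definition tdot_even (kappa : Qq) (a : nat) : A :=
  (qfact (2 * a))^-1 *:
    (tgen kappa * \prod_(i < (2 * a).-1)
        (tgen kappa - (qint (2 * (i%:Z - a%:Z + 1))) *: 1)).
Definition tdot_odd (kappa : Qq) (a : nat) : A :=
  (qfact (2 * a).+1)^-1 *:
    \prod_(i < (2 * a).+1) (tgen kappa - (qint (2 * (i%:Z - a%:Z))) *: 1).

End InU.

(* Main.v *)
Require Import Defs.
From HB Require Import structures.
From mathcomp Require Import all_boot all_order all_algebra.
From mathcomp Require Import ring zify.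
Import Order.TTheory GRing.Theory Num.Theory.
Local Open Scope ring_scope.

(** Write k = K^-1. The products defining the divided powers give
    t * t^(2m-1) = [2m] t^(2m) and
    t * t^(2m) = [2m+1] t^(2m+1) + [2m] t^(2m-1),
    so it suffices that the right-hand sides obey these recursions; kappa may
    be arbitrary.  The right-hand side for t^(N) is the normally ordered sum of
    E^(a) q^(-ar) g_(a+r)(k) F^(r) for polynomials g_b = g^N_b.  Reordering t
    times such a sum, the coefficient of E^(a) F^(b-a) is affine in q^(-2a),
    so the recursions amount to two identities between the polynomials g_b(X)
    and g_b(q^-2 X), one for each power of q^(-2a).  The linear one follows
    from the recursion of the p_n, and both hold because, as sums over c, the
    difference of their two sides telescopes. *)

(** * Polynomials in X, which stands for k: h-binomials and the terms p^(n)(kappa) X^n *)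

Section Coefficients.
Set Implicit Arguments. Unset Strict Implicit. Unset Printing Implicit Defensive.
Variables (R : fieldType) (q kappa : R) (pd : int -> R).
Hypothesis q0 : q != 0.
Hypothesis q_nroot : forall n, (0 < n)%N -> q ^+ n != 1.

(** Powers of q are kept as constant polynomials with an integer exponent, so that each identity
    below reduces to merging exponents and then a ring computation. *)
Definition qpow (x : int) : {poly R} := (q ^ x)%:P.
Local Notation Q := qpow.

Lemma qpowD x y : Q (x + y) = Q x * Q y.
Proof. by rewrite /qpow expfzDr // polyCM. Qed.

Lemma qpow0 : Q 0 = 1. Proof. by []. Qed.

Lemma qpow_mulA x y p : Q x * (Q y * p) = Q (x + y) * p.
Proof. by rewrite qpowD mulrA. Qed.

Definition hpol (a : int) (c : nat) : {poly R} :=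
  \prod_(i < c)
     ((q ^+ (4 * i.+1) - 1)^-1 *:
        (q ^ (4 * a + 4 * (i.+1)%:Z - 4) *: 'X^2 - 1)).

Lemma hpol0 a : hpol a 0 = 1. Proof. by rewrite /hpol big_ord0. Qed.

Lemma hpolS a c :
  (Q (4 * c.+1%:Z) - 1) * hpol a c.+1 = hpol a c * (Q (4 * a + 4 * c%:Z) * 'X^2 - 1).
Proof.
rewrite /hpol big_ord_recr /= mulrCA; congr (_ * _).
have -> : Q (4 * c.+1%:Z) - 1 = (q ^+ (4 * c.+1) - 1)%:P.
  by rewrite polyCB /qpow -PoszM -exprnP.
rewrite mul_polyC scalerA divff ?scale1r ?subr_eq0 ?q_nroot //.
rewrite -mul_polyC /Q; congr (_%:P * _ - _); congr (_ ^ _); lia.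
Qed.

(** Substituting q^-2 X multiplies X^2 by q^-4, which every factor absorbs by lowering a by one. *)
Lemma hpol_comp a c : hpol a c \Po (q ^ (- 2) *: 'X) = hpol (a - 1) c.
Proof.
rewrite /hpol rmorph_prod; apply: eq_bigr => i _ /=.
rewrite comp_polyZ comp_polyB comp_polyZ comp_Xn_poly comp_polyC.
congr (_ *: (_ - _)); rewrite exprZn scalerA; congr (_ *: _).
have -> : (q ^ (- 2)) ^+ 2 = q ^ (- 4) by rewrite [LHS]exprnP exprz_exp.
rewrite -expfzDr //; congr (_ ^ _); lia.
Qed.

Lemma qpow4_neq1 c : Q (4 * c.+1%:Z) - 1 != 0.
Proof.
rewrite /qpow -PoszM -exprnP -polyC1 -polyCB polyC_eq0 subr_eq0; exact: q_nroot.
Qed.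

(** The numerators for a - 1 and c + 1 are those for a and c together with one new first factor,
    whereas [hpolS] splits off the last factor. *)
Lemma hpol_head a c :
  (Q (4 * c.+1%:Z) - 1) * hpol (a - 1) c.+1 = hpol a c * (Q (4 * a - 4) * 'X^2 - 1).
Proof.
elim: c => [|c IH].
  rewrite hpolS !hpol0; congr (_ * (Q _ * _ - _)); lia.
apply: (mulfI (qpow4_neq1 c)).
rewrite hpolS !mulrA IH hpolS.
have -> : 4 * (a - 1) + 4 * c.+1%:Z = 4 * a + 4 * c%:Z by lia.
ring.
Qed.

(** The h-binomial with lower index c - 1; the value 0 at c = 0 makes both Pascal rules below hold
    there and gives the telescoping sums a zero left end. *)
Definition hpred (a : int) (c : nat) : {poly R} := if c is c'.+1 then hpol a c' else 0.

(** First of two q-Pascal rules. After multiplication by q^(4c) - 1, [hpol_head] and [hpolS] turn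
    every term into a multiple of the same shorter product. *)
Lemma hpol_shift a c : hpol (a - 1) c = hpol a c - Q (4 * a - 4) * 'X^2 * hpred a c.
Proof.
case: c => [|c] /=; first by rewrite !hpol0 mulr0 subr0.
apply: (mulfI (qpow4_neq1 c)); rewrite mulrBr hpol_head hpolS.
have -> : 4 * a + 4 * c%:Z = (4 * a - 4) + 4 * c.+1%:Z by lia.
rewrite [Q (_ - _ + _)]qpowD; ring.
Qed.

Lemma hpred_eq a c : hpred a c = hpol a c - Q (4 * c%:Z) * hpol (a - 1) c.
Proof.
case: c => [|c] /=; first by rewrite !hpol0 mulr0 qpow0 mulr1 subrr.
apply: (mulfI (qpow4_neq1 c)); rewrite mulrBr mulrCA hpol_head hpolS.
have -> : 4 * a + 4 * c%:Z = (4 * a - 4) + 4 * c.+1%:Z by lia.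
rewrite [Q (_ - _ + _)]qpowD; ring.
Qed.

(* [pd n] is the value of p^(n) at kappa. *)
Hypothesis pd_neg : forall n, n < 0 -> pd n = 0.
Hypothesis pd_rec : forall n,
  (q ^ n - q ^ (- n)) * pd n = (q - q^-1) * kappa * pd (n - 1)
    + q ^ (3 - 2 * n) * (q ^ (n - 2) - q ^ (2 - n)) * pd (n - 2).

(** The absolute value only makes the exponent a natural number: for n < 0 the coefficient is 0. *)
Definition mon (n : int) : {poly R} := pd n *: 'X^`|n|.

Lemma mon_neg n : n < 0 -> mon n = 0.
Proof. by move=> n0; rewrite /mon pd_neg // scale0r. Qed.

Lemma mon_comp n : mon n \Po (q ^ (- 2) *: 'X) = Q (- 2 * n) * mon n.
Proof.
case: n => [n|n]; last by rewrite mon_neg // comp_poly0 mulr0.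
rewrite /mon comp_polyZ comp_Xn_poly exprZn mul_polyC !scalerA mulrC.
by rewrite [_ ^+ n]exprnP exprz_exp.
Qed.

Lemma mulXmon n (k : nat) :
  pd (n - k%:Z) *: 'X^`|n| = 'X^k * mon (n - k%:Z).
Proof.
case: (ltP (n - k%:Z) 0) => nk.
  by rewrite mon_neg // pd_neg // scale0r mulr0.
rewrite /mon -scalerAr -exprD; congr (_ *: 'X^_); lia.
Qed.

(** Homogeneous form of [pd_rec]: each lowering of the index of p is compensated by a power of X. *)
Lemma mon_rec n :
  (Q n - Q (- n)) * mon n = (q - q^-1)%:P * kappa%:P * 'X * mon (n - 1)
    + Q (3 - 2 * n) * (Q (n - 2) - Q (2 - n)) * 'X^2 * mon (n - 2).
Proof.
rewrite -[_ * 'X * _]mulrA -{1}[X in 'X * mon X]/(n - 1%:Z) -['X]expr1.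
rewrite -[_ * 'X^2 * _]mulrA -[X in 'X^2 * mon X]/(n - 2%:Z) -!mulXmon.
by rewrite /qpow -!polyCB -!polyCM !mul_polyC !scalerA -scalerDl pd_rec.
Qed.

(** * The polynomials g_b as sums over c, and the identities between them *)

Variable M : nat.

(* [e = 0] and [e = 1] are the even case [N = 2m] and the odd case
   [N = 2m - 1]; [M] is any truncation of the sum beyond its support. *)
Definition gpol (e : nat) (m b : int) : {poly R} :=
  \sum_(c < M)
    Q ('C(2 * c, 2)%:Z + 2 * e%:Z * c%:Z - b * (2 * m - e%:Z - b - 2 * c%:Z)) *
    (mon (2 * m - e%:Z - b - 2 * c%:Z) * hpol (1 - m) c).

(** In each application D 0 vanishes because of [hpred], and D M because M lies beyond the support
    of the sum. *)
Lemma sum_telescope0 (T : 'I_M -> {poly R}) (D : nat -> {poly R}) :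
    (forall c : 'I_M, T c = D c - D c.+1) -> D 0%N = 0 -> D M = 0 ->
  \sum_(c < M) T c = 0.
Proof.
move=> TD D0 DM; rewrite (eq_bigr (fun c : 'I_M => - (D c.+1 - D c))) => [|c _].
  rewrite sumrN -(big_mkord xpredT (fun c => D c.+1 - D c)) telescope_sumr //.
  by rewrite D0 DM subrr oppr0.
by rewrite TD opprB.
Qed.

Lemma binS2 c : 'C(2 * c.+1, 2)%:Z = 'C(2 * c, 2)%:Z + 4 * c%:Z + 1.
Proof.
have -> : (2 * c.+1 = (2 * c).+2)%N by lia.
by rewrite !binS !bin0 !bin1; lia.
Qed.

Definition gcomp (e : nat) (m b : int) := gpol e m b \Po (q ^ (- 2) *: 'X).

Lemma gcompE e m b : gcomp e m b =
  \sum_(c < M)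
    Q ('C(2 * c, 2)%:Z + 2 * e%:Z * c%:Z - b * (2 * m - e%:Z - b - 2 * c%:Z)
       - 2 * (2 * m - e%:Z - b - 2 * c%:Z)) *
    (mon (2 * m - e%:Z - b - 2 * c%:Z) * hpol (- m) c).
Proof.
rewrite /gcomp /gpol rmorph_sum; apply: eq_bigr => c _ /=.
rewrite comp_polyM comp_polyC comp_polyM mon_comp hpol_comp -/(Q _).
have -> : 1 - m - 1 = - m by lia.
by rewrite -!mulrA mulrA -qpowD mulNr.
Qed.

(** This is the part of the coefficient of t times the normally ordered sum that carries q^(-2a), up
    to the factor q - q^-1; it has to vanish for both parities. *)
Lemma gpol_shift (e : nat) m b : 2 * m - e%:Z - b + 1 < 2 * M%:Z ->
  Q b * (gcomp e m (b - 1) - gpol e m (b - 1))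
    + (q - q^-1)%:P * kappa%:P * 'X * gpol e m b
    + Q (- b - 1) * 'X^2 * gpol e m (b + 1) = 0.
Proof.
move=> hM; rewrite gcompE /gpol -sumrB !mulr_sumr -!big_split /=.
pose z (c : nat) : int := 'C(2 * c, 2)%:Z + 2 * e%:Z * c%:Z
   - b * (2 * m - e%:Z - b + 1 - 2 * c%:Z).
pose n (c : nat) : int := 2 * m - e%:Z - b + 1 - 2 * c%:Z.
(* Here D c is the [hpred] part that [hpol_shift] splits off the [gcomp] term. All that remains is a
   multiple of [hpol (1 - m) c] and cancels by [mon_rec], whose X^2 term has two pieces: q^(1-n)
   comes from g_(b+1) and q^(5-3n) from D at c + 1. *)
apply: (sum_telescope0 (D := fun c =>
  - Q (z c + b - n c - 4 * m) * ('X^2 * mon (n c) * hpred (1 - m) c))) => [c||].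
- have -> : 2 * m - e%:Z - (b - 1) - 2 * c%:Z = n c by rewrite /n; lia.
  have -> : 2 * m - e%:Z - b - 2 * c%:Z = n c - 1 by rewrite /n; lia.
  have -> : 2 * m - e%:Z - (b + 1) - 2 * c%:Z = n c - 2 by rewrite /n; lia.
  have -> : n c.+1 = n c - 2 by rewrite /n; lia.
  have -> : hpol (- m) c = hpol (1 - m - 1) c by congr hpol; lia.
  have -> : z c.+1 + b - (n c - 2) - 4 * m = (z c + b) + (5 - 3 * n c).
    by rewrite /z binS2 /n; ring.
  have -> : 'C(2 * c, 2)%:Z + 2 * e%:Z * c%:Z - (b - 1) * n c = z c + n c.
    by rewrite /z /n; ring.
  have -> : 'C(2 * c, 2)%:Z + 2 * e%:Z * c%:Z - b * (n c - 1) = z c + b.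
    by rewrite /z /n; ring.
  have -> : 'C(2 * c, 2)%:Z + 2 * e%:Z * c%:Z - (b + 1) * (n c - 2)
           = z c + 2 * b - n c + 2.
    by rewrite /z /n; ring.
  rewrite hpol_shift /=.
  move: (n c) (z c) => {}n {}z.
  have := mon_rec n.
  move/(congr1 (fun p => - (Q (z + b)) * p * hpol (1 - m) c)) => /eqP.
  rewrite -subr_eq0 => /eqP h; apply/eqP; rewrite -subr_eq0 -h; apply/eqP.
  have -> : Q (z + n - 2 * n) = Q z * Q (- n) by rewrite -qpowD; congr Q; ring.
  have -> : Q (z + b - n - 4 * m) = Q z * Q b * Q (- n) * Q (4 * (1 - m) - 4).
    by rewrite -!qpowD; congr Q; ring.
  have -> : Q (z + 2 * b - n + 2) = Q (z + b) * Q (b + 1) * Q (1 - n).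
    by rewrite -!qpowD; congr Q; ring.
  have -> : Q (z + n) = Q z * Q n by exact: qpowD.
  have -> : Q (3 - 2 * n) * (Q (n - 2) - Q (2 - n)) = Q (1 - n) - Q (5 - 3 * n).
    by rewrite mulrBr -!qpowD; congr (Q _ - Q _); ring.
  have hb : Q (- b - 1) * (Q (z + b) * Q (b + 1) * Q (1 - n)) = Q (z + b) * Q (1 - n).
    by rewrite -!qpowD; congr Q; ring.
  have -> p x : Q (- b - 1) * 'X^2 * (Q (z + b) * Q (b + 1) * Q (1 - n) * (p * x))
      = Q (z + b) * Q (1 - n) * 'X^2 * p * x by rewrite -hb; ring.
  rewrite [Q (z + b + _)]qpowD [Q (z + b)]qpowD; ring.
- by rewrite /= !mulr0.
- by rewrite mon_neg ?mulr0 ?mul0r ?mulr0 // /n; lia.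
Qed.

(** The part free of q^(-2a) in t * t^(2m-1) = [2m] t^(2m), multiplied by q - q^-1. *)
Lemma gpol_odd_to_even (m b : int) : 2 * m - b < 2 * M%:Z ->
  Q b * gpol 1 m (b - 1) - Q (- b) * gcomp 1 m (b - 1)
    - Q (- b - 1) * gpol 1 m (b + 1)
  = (Q (2 * m) - Q (- 2 * m)) * gpol 0 m b.
Proof.
move=> hM; apply/eqP; rewrite -subr_eq0; apply/eqP.
rewrite gcompE /gpol !mulr_sumr -!sumrB /=.
pose z (c : nat) : int := 'C(2 * c, 2)%:Z - b * (2 * m - b - 2 * c%:Z).
pose n (c : nat) : int := 2 * m - b - 2 * c%:Z.
(* Since 2m = b + 2c + n, the q^(2m) term cancels the g_(b-1) term. The other terms with [mon n]
   form D c by [hpred_eq], and the g_(b+1) term is D at c + 1. *)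
apply: (sum_telescope0 (D := fun c =>
  Q (z c - b - 2 * c%:Z - n c) * (mon (n c) * hpred (1 - m) c))) => [c||].
- have -> : 2 * m - 1%:Z - (b - 1) - 2 * c%:Z = n c by rewrite /n; lia.
  have -> : 2 * m - 0%:Z - b - 2 * c%:Z = n c by rewrite /n; lia.
  have -> : 2 * m - 1%:Z - (b + 1) - 2 * c%:Z = n c - 2 by rewrite /n; lia.
  have -> : n c.+1 = n c - 2 by rewrite /n; lia.
  have -> : hpol (- m) c = hpol (1 - m - 1) c by congr hpol; lia.
  have -> : z c.+1 - b - 2 * c.+1%:Z - (n c - 2) = z c + (b + 2 * c%:Z - n c + 1).
    by rewrite /z binS2 /n; lia.
  have -> : 'C(2 * c, 2)%:Z + 2 * 1%:Z * c%:Z - (b - 1) * n c = z c + (2 * c%:Z + n c).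
    by rewrite /z /n; ring.
  have -> : 'C(2 * c, 2)%:Z + 2 * 0%:Z * c%:Z - b * n c = z c.
    by rewrite /z /n; ring.
  have -> : 'C(2 * c, 2)%:Z + 2 * 1%:Z * c%:Z - (b + 1) * (n c - 2)
           = z c + (b + 2 * c%:Z - n c + 1) + (b + 1).
    by rewrite /z /n; ring.
  have -> : 2 * m = b + 2 * c%:Z + n c by rewrite /n; lia.
  have -> : - 2 * m = - (b + 2 * c%:Z + n c) by rewrite /n; lia.
  rewrite hpred_eq /=.
  move: (n c) (z c) => {}n {}z.
  set h := hpol (1 - m) c; set hs := hpol (1 - m - 1) c.
  have -> x : Q x * (mon n * (h - Q (4 * c%:Z) * hs))
      = Q x * (mon n * h) - Q (x + 4 * c%:Z) * (mon n * hs) by rewrite qpowD; ring.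
  rewrite !mulrBl !qpow_mulA.
  have -> : b + (z + (2 * c%:Z + n)) = b + 2 * c%:Z + n + z by ring.
  have -> : - b + (z + (2 * c%:Z + n) - 2 * n) = z - b - 2 * c%:Z - n + 4 * c%:Z by ring.
  have -> : - b - 1 + (z + (b + 2 * c%:Z - n + 1) + (b + 1))
      = z + (b + 2 * c%:Z - n + 1) by ring.
  have -> : - (b + 2 * c%:Z + n) + z = z - b - 2 * c%:Z - n by ring.
  ring.
- by rewrite /= ?mulr0.
- by rewrite mon_neg ?mul0r ?mulr0 // /n; lia.
Qed.

(** The part free of q^(-2a) in t * t^(2m) = [2m+1] t^(2m+1) + [2m] t^(2m-1), multiplied by q -
    q^-1. The h-binomials of t^(2m+1) have the same parameter -m as those of [gcomp]. *)
Lemma gpol_even_to_odd (m b : int) : 2 * m - b + 1 < 2 * M%:Z ->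
  Q b * gpol 0 m (b - 1) - Q (- b) * gcomp 0 m (b - 1)
    - Q (- b - 1) * gpol 0 m (b + 1)
  = (Q (2 * m + 1) - Q (- (2 * m + 1))) * gpol 1 (m + 1) b
    + (Q (2 * m) - Q (- 2 * m)) * gpol 1 m b.
Proof.
move=> hM; apply/eqP; rewrite -subr_eq0; apply/eqP.
rewrite gcompE /gpol !mulr_sumr -!sumrB -big_split -sumrB /=.
pose z (c : nat) : int := 'C(2 * c, 2)%:Z - b * (2 * m - b + 1 - 2 * c%:Z).
pose n (c : nat) : int := 2 * m - b + 1 - 2 * c%:Z.
(* With 2m + 1 = b + 2c + n, the q^(-2m-1) term cancels the [gcomp] term and the q^(-2m) term
   cancels the g_(b+1) term. What is left with [mon n] is D c by [hpred_eq], and what is left with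
   [mon (n - 2)] is D at c + 1. *)
apply: (sum_telescope0 (D := fun c =>
  Q (z c + b + n c) * (mon (n c) * hpred (1 - m) c))) => [c||].
- have -> : 2 * m - 0%:Z - (b - 1) - 2 * c%:Z = n c by rewrite /n; lia.
  have -> : 2 * (m + 1) - 1%:Z - b - 2 * c%:Z = n c by rewrite /n; lia.
  have -> : 2 * m - 0%:Z - (b + 1) - 2 * c%:Z = n c - 2 by rewrite /n; lia.
  have -> : 2 * m - 1%:Z - b - 2 * c%:Z = n c - 2 by rewrite /n; lia.
  have -> : n c.+1 = n c - 2 by rewrite /n; lia.
  have -> : hpol (- m) c = hpol (1 - m - 1) c by congr hpol; lia.
  have -> : hpol (1 - (m + 1)) c = hpol (1 - m - 1) c by congr hpol; lia.
  have -> : z c.+1 + b + (n c - 2) = z c + (3 * b + 4 * c%:Z + n c - 1).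
    by rewrite /z binS2 /n; lia.
  have -> : 'C(2 * c, 2)%:Z + 2 * 0%:Z * c%:Z - (b - 1) * n c = z c + n c.
    by rewrite /z /n; ring.
  have -> : 'C(2 * c, 2)%:Z + 2 * 1%:Z * c%:Z - b * n c = z c + 2 * c%:Z.
    by rewrite /z /n; ring.
  have -> : 'C(2 * c, 2)%:Z + 2 * 0%:Z * c%:Z - (b + 1) * (n c - 2)
           = z c + (2 * b - n c + 2).
    by rewrite /z /n; ring.
  have -> : 'C(2 * c, 2)%:Z + 2 * 1%:Z * c%:Z - b * (n c - 2)
           = z c + 2 * c%:Z + 2 * b.
    by rewrite /z /n; ring.
  have -> : - 2 * m = - (2 * m) by rewrite mulNr.
  have -> : 2 * m = b + 2 * c%:Z + n c - 1 by rewrite /n; lia.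
  rewrite hpred_eq /=.
  move: (n c) (z c) => {}n {}z.
  set h := hpol (1 - m) c; set hs := hpol (1 - m - 1) c.
  have -> x : Q x * (mon n * (h - Q (4 * c%:Z) * hs))
      = Q x * (mon n * h) - Q (x + 4 * c%:Z) * (mon n * hs) by rewrite qpowD; ring.
  rewrite !mulrBl !qpow_mulA.
  have -> : b + (z + n) = z + b + n by ring.
  have -> : - b + (z + n - 2 * n) = - (b + 2 * c%:Z + n - 1 + 1) + (z + 2 * c%:Z) by ring.
  have -> : - b - 1 + (z + (2 * b - n + 2))
      = - (b + 2 * c%:Z + n - 1) + (z + 2 * c%:Z + 2 * b) by ring.
  have -> : b + 2 * c%:Z + n - 1 + 1 + (z + 2 * c%:Z) = z + b + n + 4 * c%:Z by ring.
  have -> : b + 2 * c%:Z + n - 1 + (z + 2 * c%:Z + 2 * b)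
      = z + (3 * b + 4 * c%:Z + n - 1) by ring.
  ring.
- by rewrite /= ?mulr0.
- by rewrite mon_neg ?mul0r ?mulr0 // /n; lia.
Qed.

Lemma gpol_eq0 (e : nat) (m b : int) : 2 * m - e%:Z < b -> gpol e m b = 0.
Proof.
move=> hb; rewrite /gpol big1 // => c _.
by rewrite mon_neg ?mul0r ?mulr0 //; lia.
Qed.

Lemma gpol00 : (0 < M)%N -> pd 0 = 1 -> gpol 0 0 0 = 1.
Proof.
move=> M0 pd0; rewrite /gpol.
rewrite (bigD1 (Ordinal M0)) //= big1 ?addr0 => [|c c0].
  by rewrite hpol0 /mon pd0 scale1r mulr1 muln0 mulr1.
rewrite mon_neg ?mul0r ?mulr0 //.
have : nat_of_ord c != 0%N by apply: contra c0 => /eqP c0; apply/eqP/val_inj.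
lia.
Qed.

End Coefficients.

Lemma horner_algZ (R : comNzRingType) (A : algType R) (k : A) (c : R) (p : {poly R}) :
  horner_alg k (c *: p) = c *: horner_alg k p.
Proof. by rewrite -mul_polyC rmorphM /= horner_algC mulr_algl. Qed.

(** * Quantum integers and reordering rules for E-check, k and F *)

Section NormalOrder.
Set Implicit Arguments. Unset Strict Implicit. Unset Printing Implicit Defensive.
Variables (R : fieldType) (q kappa : R).
Hypothesis q0 : q != 0.
Hypothesis q_nroot : forall n, (0 < n)%N -> q ^+ n != 1.

Lemma sum_ord_shift (V : zmodType) (L : nat) (psi : nat -> V) :
  psi 0%N = 0 -> psi L = 0 -> \sum_(i < L) psi i.+1 = \sum_(i < L) psi i.
Proof.
move=> psi0 psiL.
transitivity (\sum_(i < L.+1) psi i); last by rewrite big_ord_recr /= psiL addr0.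
by rewrite big_ord_recl psi0 add0r.
Qed.

(** Over Q(q) this is convertible to [qint], so facts proved over R transfer directly. *)
Definition qnum (n : int) : R := (q ^ n - q ^ (- n)) / (q - q^-1).
Definition qnum_fact (n : nat) : R := \prod_(i < n) qnum (i.+1)%:Z.

Lemma subqV_neq0 : q - q^-1 != 0.
Proof.
by rewrite subr_eq0 -(inj_eq (mulfI q0)) divff // -expr2 q_nroot.
Qed.

Lemma qnum0 : qnum 0 = 0.
Proof. by rewrite /qnum subrr mul0r. Qed.

Lemma qnumN n : qnum (- n) = - qnum n.
Proof. by rewrite /qnum opprK -mulNr opprB. Qed.

Lemma qnumE n : (q - q^-1) * qnum n = q ^ n - q ^ (- n).
Proof. by rewrite /qnum mulrC divfK // subqV_neq0. Qed.

Lemma qnum_succ n : qnum (n + 1) = q ^ n + qnum n * q ^ (- 1).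
Proof.
apply: (mulfI subqV_neq0); rewrite mulrDr [_ * (qnum n * _)]mulrA !qnumE.
by rewrite opprD !expfzDr // expr1z exprN1; ring.
Qed.

Lemma qnum_succV n : qnum (n + 1) = q ^ (- n) + qnum n * q ^ 1.
Proof.
apply: (mulfI subqV_neq0); rewrite mulrDr [_ * (qnum n * _)]mulrA !qnumE.
by rewrite opprD !expfzDr // expr1z exprN1; ring.
Qed.

Lemma qnum_neq0 n : (0 < n)%N -> qnum n != 0.
Proof.
move=> n0; rewrite mulf_neq0 ?invr_neq0 ?subqV_neq0 // subr_eq0.
rewrite -(inj_eq (mulfI (expfz_neq0 n%:Z q0))) -!expfzDr // subrr -PoszD.
by rewrite -exprnP q_nroot // addn_gt0 n0.
Qed.

Lemma qnum_factS n : qnum_fact n.+1 = qnum_fact n * qnum n.+1.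
Proof. by rewrite /qnum_fact big_ord_recr. Qed.

Lemma qnum_fact_neq0 n : qnum_fact n != 0.
Proof. by apply/prodf_neq0 => i _; exact: qnum_neq0. Qed.

(* [D] and [k] stand for the generators E-check and K^-1. *)
Variables (A : algType R) (D F k : A).
Hypothesis kD : k * D = q ^ (- 2) *: (D * k).
Hypothesis Fk : F * k = q ^ (- 2) *: (k * F).
Hypothesis FD : F * D = q ^ (- 2) *: (D * F) + (q ^+ 2 - 1)^-1 *: (k ^+ 2 - 1).

Let s : {poly R} := q ^ (- 2) *: 'X.
Let ev (p : {poly R}) : A := horner_alg k p.

Lemma evX : ev 'X = k. Proof. exact: horner_algX. Qed.
Lemma evC c : ev c%:P = c%:A. Proof. exact: horner_algC. Qed.
Lemma evM p r : ev (p * r) = ev p * ev r. Proof. exact: rmorphM. Qed.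
Lemma evD p r : ev (p + r) = ev p + ev r. Proof. exact: rmorphD. Qed.
Lemma evZ c p : ev (c *: p) = c *: ev p. Proof. exact: horner_algZ. Qed.

(** Moving k past D costs q^-2, hence a polynomial in k passes D by the substitution X -> q^-2 X. *)
Lemma ev_mulD p : ev p * D = D * ev (p \Po s).
Proof.
elim/poly_ind: p => [|p c IH]; first by rewrite comp_poly0 /ev rmorph0 mul0r mulr0.
rewrite comp_poly_MXaddC !evD !evM !evC evX evZ evX mulrDl mulrDr mulr_algl mulr_algr.
by rewrite -mulrA kD -!scalerAr !mulrA IH.
Qed.

Lemma F_mulev p : F * ev p = ev (p \Po s) * F.
Proof.
elim/poly_ind: p => [|p c IH]; first by rewrite comp_poly0 /ev rmorph0 mul0r mulr0.
rewrite comp_poly_MXaddC !evD !evM !evC evX evZ evX mulrDl mulrDr mulr_algl mulr_algr.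
by rewrite mulrA IH -mulrA Fk -!scalerAr -scalerAl mulrA.
Qed.

Definition Ddiv (n : nat) : A := (qnum_fact n)^-1 *: D ^+ n.
Definition Fdiv (n : nat) : A := (qnum_fact n)^-1 *: F ^+ n.

Lemma D_Ddiv n : D * Ddiv n = qnum n.+1 *: Ddiv n.+1.
Proof.
rewrite /Ddiv qnum_factS scalerA invfM mulrCA divff ?qnum_neq0 // mulr1.
by rewrite -scalerAr -exprS.
Qed.

Lemma F_Fdiv n : F * Fdiv n = qnum n.+1 *: Fdiv n.+1.
Proof.
rewrite /Fdiv qnum_factS scalerA invfM mulrCA divff ?qnum_neq0 // mulr1.
by rewrite -scalerAr -exprS.
Qed.

Lemma k_Dexp n : k * D ^+ n = q ^ (- 2 * n%:Z) *: (D ^+ n * k).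
Proof.
elim: n => [|n IH]; first by rewrite mulr0 expr0z scale1r mulr1 mul1r.
rewrite exprSr mulrA IH -scalerAl -[_ * k * D]mulrA kD -scalerAr scalerA mulrA.
rewrite -expfzDr //; congr (q ^ _ *: _); lia.
Qed.

(** The polynomial in k left over when F passes the divided power D^(n+1); for n = 0 it is the
    inhomogeneous term of [FD]. *)
Definition Ecomm (n : nat) : {poly R} :=
  (q ^+ 2 - 1)^-1 *: (q ^ (- 3 * n%:Z) *: 'X^2 - (q ^ (- n%:Z))%:P).

Lemma Ecomm_comp n : Ecomm n \Po s =
  (q ^+ 2 - 1)^-1 *: (q ^ (- 3 * n%:Z - 4) *: 'X^2 - (q ^ (- n%:Z))%:P).
Proof.
rewrite /Ecomm comp_polyZ comp_polyB comp_polyZ comp_Xn_poly comp_polyC.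
congr (_ *: (_ - _)); rewrite exprZn scalerA; congr (_ *: _).
have -> : (q ^ (- 2)) ^+ 2 = q ^ (- 4) by rewrite [LHS]exprnP exprz_exp.
by rewrite -expfzDr.
Qed.

Lemma scalerC (a b : R) (v : {poly R}) : a *: (b *: v) = b *: (a *: v).
Proof. by rewrite !scalerA mulrC. Qed.

Lemma Ecomm_rec n : qnum n.+2 *: Ecomm n.+1
  = q ^ (- 2 * n.+1%:Z) *: Ecomm 0 + qnum n.+1 *: (Ecomm n \Po s).
Proof.
rewrite Ecomm_comp /Ecomm !(scalerC _ (q ^+ 2 - 1)^-1) -scalerDr.
congr (_ *: _).
(* The two coefficients need the two splittings of [n+2]: q^(n+1) + q^-1 [n+1] for X^2, and q^(-n-1)
   + q [n+1] for the constant term. *)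
have hA : qnum n.+2 * q ^ (- 3 * n.+1%:Z) =
    q ^ (- 2 * n.+1%:Z) * q ^ (- 3 * 0) + qnum n.+1 * q ^ (- 3 * n%:Z - 4).
  have -> : n.+2%:Z = n.+1%:Z + 1 by lia.
  rewrite qnum_succ mulrDl -mulrA -!expfzDr //.
  by congr (q ^ _ + _ * q ^ _); lia.
have hB : qnum n.+2 * q ^ (- n.+1%:Z) =
    q ^ (- 2 * n.+1%:Z) * q ^ (- 0) + qnum n.+1 * q ^ (- n%:Z).
  have -> : n.+2%:Z = n.+1%:Z + 1 by lia.
  rewrite qnum_succV mulrDl -mulrA -!expfzDr //.
  by congr (q ^ _ + _ * q ^ _); lia.
have scaleC (c d : R) : c *: d%:P = (c * d)%:P by rewrite -mul_polyC polyCM.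
rewrite !scalerBr !scalerA !scaleC hA hB scalerDl polyCD addrACA.
by congr (_ + _); exact: opprD.
Qed.

Lemma F_Dexp n : F * D ^+ n.+1 = q ^ (- 2 * n.+1%:Z) *: (D ^+ n.+1 * F)
   + qnum n.+1 *: (D ^+ n * ev (Ecomm n)).
Proof.
have ev0 : (q ^+ 2 - 1)^-1 *: (k ^+ 2 - 1) = ev (Ecomm 0).
  rewrite /Ecomm evZ mulr0 oppr0 expr0z scale1r /ev rmorphB rmorphXn /=.
  by rewrite horner_algX rmorph1.
elim: n => [|n IH].
  rewrite expr1 FD expr0 mul1r ev0 /qnum divff ?subqV_neq0 //.
  by rewrite scale1r.
rewrite exprSr mulrA IH mulrDl -!scalerAl -!mulrA FD ev_mulD mulrDr scalerDr.
rewrite -scalerAr scalerA -addrA; congr (_ + _).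
  rewrite !mulrA -exprSr -expfzDr //; congr (q ^ _ *: _); lia.
rewrite ev0 [D ^+ n * _]mulrA -exprSr !scalerAr -mulrDr; congr (_ * _).
by rewrite -!evZ -evD -Ecomm_rec.
Qed.

Lemma F_Ddiv n : F * Ddiv n.+1 = q ^ (- 2 * n.+1%:Z) *: (Ddiv n.+1 * F)
   + Ddiv n * ev (Ecomm n).
Proof.
rewrite /Ddiv -scalerAr F_Dexp scalerDr -scalerAl; congr (_ + _).
  by rewrite !scalerA mulrC.
rewrite scalerA -scalerAl; congr (_ *: _).
by rewrite qnum_factS invfM divfK ?qnum_neq0.
Qed.

Lemma k_Ddiv n : k * Ddiv n = q ^ (- 2 * n%:Z) *: (Ddiv n * k).
Proof. by rewrite /Ddiv -scalerAr k_Dexp -scalerAl scalerA mulrC -scalerA. Qed.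

(** * Left multiplication by t on normally ordered sums *)

Variable L : nat.

Definition normal_sum (f : nat -> nat -> {poly R}) : A :=
  \sum_(a < L) \sum_(r < L) Ddiv a * ev (f a r) * Fdiv r.

Definition tgenk : A := F + D + kappa *: k.

(* At [a = 0] or [r = 0] the predecessor is truncated, but its weight is [0] = 0. *)
Definition tgen_coef (f : nat -> nat -> {poly R}) (a r : nat) : {poly R} :=
  qnum a *: f a.-1 r + (q ^ (- 2 * a%:Z) * qnum r) *: (f a r.-1 \Po s)
    + Ecomm a * f a.+1 r + (kappa * q ^ (- 2 * a%:Z)) *: ('X * f a r).

(** D raises a, F raises r or lowers a through [Ecomm], and k changes only the middle polynomial.
    The support condition on f keeps raised indices below L. *)
Lemma tgenk_normal_sum f : (forall a r, (L <= (a + r).+1)%N -> f a r = 0) ->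
  tgenk * normal_sum f = normal_sum (tgen_coef f).
Proof.
move=> f0.
have mulD : D * normal_sum f
    = \sum_(a < L) \sum_(r < L) Ddiv a * ev (qnum a *: f a.-1 r) * Fdiv r.
  rewrite mulr_sumr.
  rewrite -(sum_ord_shift (psi := fun a : nat =>
    \sum_(r < L) Ddiv a * ev (qnum a *: f a.-1 r) * Fdiv r)).
  - apply: eq_bigr => a _; rewrite mulr_sumr; apply: eq_bigr => r _ /=.
    by rewrite !mulrA D_Ddiv evZ -!scalerAr -!scalerAl.
  - by apply: big1 => r _; rewrite qnum0 evZ scale0r mulr0 mul0r.
  - apply: big1 => r _; rewrite f0 ?scaler0 /ev ?rmorph0 ?mulr0 ?mul0r //; lia.
have mulk : (kappa *: k) * normal_sum f
    = \sum_(a < L) \sum_(r < L)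
        Ddiv a * ev ((kappa * q ^ (- 2 * a%:Z)) *: ('X * f a r)) * Fdiv r.
  rewrite mulr_sumr; apply: eq_bigr => a _.
  rewrite mulr_sumr; apply: eq_bigr => r _.
  rewrite -scalerAl !mulrA k_Ddiv evZ evM evX -scalerA.
  move: (Ddiv a) (ev _) (Fdiv r) => d p g.
  by rewrite -!scalerAl -!scalerAr -!scalerAl !mulrA.
have mulF : F * normal_sum f
    = \sum_(a < L) \sum_(r < L)
        (Ddiv a * ev ((q ^ (- 2 * a%:Z) * qnum r) *: (f a r.-1 \Po s)) * Fdiv r)
    + \sum_(a < L) \sum_(r < L) Ddiv a * ev (Ecomm a * f a.+1 r) * Fdiv r.
  (* The [Ecomm] contribution, indexed by the power of D that F crosses; at a = 0 nothing is
     crossed. Shifting the index by one files it under the power of D that remains. *)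
  pose lower (a : nat) : A := \sum_(r < L)
    (if a is a'.+1 then Ddiv a' * ev (Ecomm a' * f a r) * Fdiv r else 0).
  rewrite [X in _ + X](_ : _ = \sum_(a < L) lower a); last first.
    rewrite -(sum_ord_shift (psi := lower)) //; first by apply: big1.
    rewrite /lower; case: (L) f0 => [|L'] f0; first by rewrite big_ord0.
    apply: big1 => r _; rewrite f0 ?mulr0 /ev ?rmorph0 ?mulr0 ?mul0r //; lia.
  rewrite -big_split mulr_sumr; apply: eq_bigr => a _ /=.
  rewrite -(sum_ord_shift (psi := fun r : nat =>
    Ddiv a * ev ((q ^ (- 2 * a%:Z) * qnum r) *: (f a r.-1 \Po s)) * Fdiv r)).
  - rewrite /lower -big_split mulr_sumr; apply: eq_bigr => [[r ?] _] /=.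
    have FevF : ev (f a r \Po s) * F * Fdiv r = qnum r.+1 *: (ev (f a r \Po s) * Fdiv r.+1).
      by rewrite -mulrA F_Fdiv -scalerAr.
    case: (nat_of_ord a) FevF => [|a'] FevF.
      rewrite addr0 mulr0 expr0z mul1r /Ddiv /qnum_fact big_ord0 invr1 scale1r expr0.
      by rewrite !mul1r mulrA F_mulev FevF evZ scalerAl.
    rewrite !mulrA F_Ddiv !mulrDl evM !mulrA; congr (_ + _).
    move: (Ddiv a'.+1) => d.
    rewrite -!scalerAl -!mulrA [F * (_ * _)]mulrA F_mulev FevF evZ -/(qnum _).
    move: (ev _) (Fdiv _) (qnum _) => p g x.
    by rewrite -!scalerAl -!scalerAr scalerA.
  - by rewrite qnum0 mulr0 scale0r /ev rmorph0 mulr0 mul0r.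
  - rewrite f0 ?comp_poly0 ?scaler0 /ev ?rmorph0 ?mulr0 ?mul0r //; lia.
rewrite /tgenk !mulrDl mulF mulD mulk /normal_sum -!big_split.
apply: eq_bigr => a _; rewrite -!big_split; apply: eq_bigr => r _ /=.
rewrite -!mulrDl -!mulrDr -!evD /tgen_coef; congr (_ * ev _ * _); ring.
Qed.

(** * The recursions for the right-hand sides *)

Variable pd : int -> R.
Hypothesis pd_neg : forall n, n < 0 -> pd n = 0.
Hypothesis pd_rec : forall n,
  (q ^ n - q ^ (- n)) * pd n = (q - q^-1) * kappa * pd (n - 1)
    + q ^ (3 - 2 * n) * (q ^ (n - 2) - q ^ (2 - n)) * pd (n - 2).
Hypothesis pd0 : pd 0 = 1.

Local Notation Q := (qpow q).

Variable M : nat.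
Let g := gpol q pd M.
Let gs := gcomp q pd M.

Definition gcoef (e : nat) (m : int) (a r : nat) : {poly R} :=
  q ^ (- (a%:Z * r%:Z)) *: g e m (a%:Z + r%:Z).

(** Times q - q^-1, the coefficient is q^(-ar) times the left side of the assumed identity plus
    q^(-ar-2a) times the left side of [gpol_shift], which is 0. Leaving h free serves both
    parities. *)
Lemma tgen_coef_gcoef (e : nat) (m : int) (a r : nat) (h : {poly R}) :
    2 * m - e%:Z + 1 < 2 * M%:Z ->
    let b := a%:Z + r%:Z in
    Q b * g e m (b - 1) - Q (- b) * gs e m (b - 1) - Q (- b - 1) * g e m (b + 1)
      = (q - q^-1) *: h ->
  tgen_coef (gcoef e m) a r = q ^ (- (a%:Z * r%:Z)) *: h.
Proof.
move=> hM b hb; apply: (scalerI subqV_neq0).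
rewrite scalerA mulrC -scalerA -hb.
have id2 : Q b * (gs e m (b - 1) - g e m (b - 1))
    + (q - q^-1)%:P * kappa%:P * 'X * g e m b
    + Q (- b - 1) * 'X^2 * g e m (b + 1) = 0.
  by apply: gpol_shift => //; rewrite /b; lia.
rewrite /tgen_coef ![in LHS]scalerDr.
have -> : (q - q^-1) *: (qnum a *: gcoef e m a.-1 r)
    = (Q a - Q (- a%:Z)) * (Q (r%:Z - a%:Z * r%:Z) * g e m (b - 1)).
  rewrite scalerA qnumE -mul_polyC polyCB; case: (a) @b {hb id2} => [|a'] b.
    by rewrite oppr0 /qpow subrr !mul0r.
  rewrite /gcoef -mul_polyC /qpow; congr (_ * (_%:P * g e m _)).
    congr (q ^ _); lia.
  rewrite /b; lia.
have -> : (q - q^-1) *: ((q ^ (- 2 * a%:Z) * qnum r) *: (gcoef e m a r.-1 \Po s))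
    = Q (- 2 * a%:Z) * (Q r - Q (- r%:Z)) * (Q (a%:Z - a%:Z * r%:Z) * gs e m (b - 1)).
  rewrite scalerA mulrCA qnumE -mul_polyC polyCM polyCB -[RHS]mulrA -[LHS]mulrA.
  congr (_ * _); case: (r) @b {hb id2} => [|r'] b.
    by rewrite oppr0 /qpow subrr !mul0r.
  rewrite /gcoef comp_polyZ -mul_polyC /qpow; congr (_ * (_%:P * (g e m _ \Po _))).
    congr (q ^ _); lia.
  rewrite /b; lia.
have -> : (q - q^-1) *: (Ecomm a * gcoef e m a.+1 r)
    = Q (- 1) * (Q (- 3 * a%:Z) * 'X^2 - Q (- a%:Z))
        * (Q (- r%:Z - a%:Z * r%:Z) * g e m (b + 1)).
  rewrite scalerAl /Ecomm scalerA.
  have -> : (q - q^-1) * (q ^+ 2 - 1)^-1 = q ^ (- 1).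
    have -> : q ^+ 2 - 1 = q * (q - q^-1) by rewrite mulrBr divff.
    by rewrite invfM mulrCA divff ?subqV_neq0 // mulr1 exprN1.
  rewrite /gcoef -!mul_polyC /qpow; congr (_ * (_%:P * g e m _)).
    congr (q ^ _); lia.
  rewrite /b; lia.
have -> : (q - q^-1) *: ((kappa * q ^ (- 2 * a%:Z)) *: ('X * gcoef e m a r))
    = Q (- (a%:Z * r%:Z) - 2 * a%:Z) * ((q - q^-1)%:P * kappa%:P * 'X * g e m b).
  rewrite qpowD // /gcoef -!mul_polyC !polyCM /qpow mulNr; ring.
(* The exponents z and w label the two parts: each term is now rewritten as a combination of q^z and
   q^w. *)
set z := - (a%:Z * r%:Z); set w := z - 2 * a%:Z.
rewrite -mul_polyC -/(Q z).
have -> p : (Q a - Q (- a%:Z)) * (Q (r%:Z - a%:Z * r%:Z) * p)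
    = (Q z * Q b - Q w * Q b) * p.
  rewrite mulrA mulrBl -!qpowD //; congr ((Q _ - Q _) * _); rewrite /w /z /b; ring.
have -> p : Q (- 2 * a%:Z) * (Q r - Q (- r%:Z)) * (Q (a%:Z - a%:Z * r%:Z) * p)
    = (Q w * Q b - Q z * Q (- b)) * p.
  rewrite mulrA mulrBr mulrBl -!qpowD //; congr ((Q _ - Q _) * _); rewrite /w /z /b; ring.
have -> p : Q (- 1) * (Q (- 3 * a%:Z) * 'X^2 - Q (- a%:Z)) * (Q (- r%:Z - a%:Z * r%:Z) * p)
    = (Q w * Q (- b - 1) * 'X^2 - Q z * Q (- b - 1)) * p.
  rewrite mulrA mulrBr mulrBl mulrA mulrAC -!qpowD //.
  congr ((Q _ * _ - Q _) * _); rewrite /w /z /b; ring.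
rewrite -[RHS]addr0 -[X in _ = _ + X](mulr0 (Q w)) -[X in _ = _ + Q w * X]id2.
ring.
Qed.

Lemma eq_normal_sum f h : (forall a r, f a r = h a r) -> normal_sum f = normal_sum h.
Proof. by move=> fh; apply: eq_bigr => a _; apply: eq_bigr => r _; rewrite fh. Qed.

Lemma normal_sumZ c f : normal_sum (fun a r => c *: f a r) = c *: normal_sum f.
Proof.
rewrite scaler_sumr; apply: eq_bigr => a _; rewrite scaler_sumr; apply: eq_bigr => r _.
by rewrite evZ; move: (Ddiv a) (Fdiv r) => d p; rewrite -scalerAr -scalerAl.
Qed.

Lemma normal_sumD f h :
  normal_sum (fun a r => f a r + h a r) = normal_sum f + normal_sum h.
Proof.
rewrite -big_split; apply: eq_bigr => a _; rewrite -big_split; apply: eq_bigr => r _ /=.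
by rewrite evD mulrDr mulrDl.
Qed.

Lemma gcoef_eq0 (e : nat) (m : int) a r :
  2 * m - e%:Z < a%:Z + r%:Z -> gcoef e m a r = 0.
Proof. by move=> h; rewrite /gcoef /g gpol_eq0 ?scaler0. Qed.

Lemma qnum_mulp n (p : {poly R}) :
  (Q n - Q (- n)) * p = (q - q^-1) *: (qnum n *: p).
Proof. by rewrite scalerA qnumE /qpow -polyCB mul_polyC. Qed.

Lemma tgenk_odd (m : nat) : (2 * m < L)%N -> (m < M)%N ->
  tgenk * normal_sum (gcoef 1 m) = qnum (2 * m%:Z) *: normal_sum (gcoef 0 m).
Proof.
move=> mL mM; rewrite tgenk_normal_sum => [|a r ar]; last by apply: gcoef_eq0; lia.
rewrite -normal_sumZ; apply: eq_normal_sum => a r.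
rewrite (tgen_coef_gcoef (h := qnum (2 * m%:Z) *: g 0 m (a%:Z + r%:Z))).
- exact: scalerC.
- lia.
- rewrite /g /gs gpol_odd_to_even //; last by lia.
  by rewrite -qnum_mulp mulNr.
Qed.

Lemma tgenk_even (m : nat) : (2 * m + 2 <= L)%N -> (m < M)%N ->
  tgenk * normal_sum (gcoef 0 m) =
    qnum (2 * m%:Z + 1) *: normal_sum (gcoef 1 (m%:Z + 1))
    + qnum (2 * m%:Z) *: normal_sum (gcoef 1 m).
Proof.
move=> mL mM; rewrite tgenk_normal_sum => [|a r ar]; last by apply: gcoef_eq0; lia.
rewrite -!normal_sumZ -normal_sumD; apply: eq_normal_sum => a r.
rewrite (tgen_coef_gcoef (h := qnum (2 * m%:Z + 1) *: g 1 (m%:Z + 1) (a%:Z + r%:Z)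
  + qnum (2 * m%:Z) *: g 1 m (a%:Z + r%:Z))).
- by rewrite /gcoef scalerDr !(scalerC (q ^ _)).
- lia.
- rewrite /g /gs gpol_even_to_odd //; last by lia.
  by rewrite scalerDr -!qnum_mulp mulNr.
Qed.

Lemma normal_sum_gcoef00 : (0 < L)%N -> (0 < M)%N -> normal_sum (gcoef 0 0) = 1.
Proof.
move=> L0 M0; rewrite /normal_sum (bigD1 (Ordinal L0)) //= (bigD1 (Ordinal L0)) //=.
have nz (i : 'I_L) : i != Ordinal L0 -> nat_of_ord i != 0%N.
  by apply: contra => /eqP i0; apply/eqP/val_inj.
rewrite big1 => [|r /nz r0]; last first.
  by rewrite gcoef_eq0 /ev ?rmorph0 ?mulr0 ?mul0r //; lia.
rewrite big1 => [|a /nz a0]; last first.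
  by apply: big1 => r _; rewrite gcoef_eq0 /ev ?rmorph0 ?mulr0 ?mul0r //; lia.
rewrite !addr0 /gcoef /g mulr0 oppr0 expr0z addr0 gpol00 // scale1r /ev rmorph1.
by rewrite /Ddiv /Fdiv /qnum_fact big_ord0 invr1 !scale1r !expr0 !mulr1.
Qed.

(** * The products in t and their normally ordered form *)

Definition tprod (m : nat) : A :=
  \prod_(i < (2 * m).+1) (tgenk - qnum (2 * (i%:Z - m%:Z)) *: 1).

(** The two new end factors are t + [2m+2] and t - [2m+2]. All factors are polynomials in t, so they
    are rearranged in R[X] and then evaluated at t. *)
Lemma tprodS m :
  tprod m.+1 = tgenk * (tgenk * tprod m) - qnum (2 * m.+1%:Z) ^+ 2 *: tprod m.
Proof.
pose W n : {poly R} := \prod_(i < (2 * n).+1) ('X - (qnum (2 * (i%:Z - n%:Z)))%:P).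
have tprodW n : tprod n = horner_alg tgenk (W n).
  rewrite /W rmorph_prod; apply: eq_bigr => i _.
  by rewrite rmorphB /= horner_algX horner_algC.
have WS : W m.+1 = 'X * ('X * W m) - (qnum (2 * m.+1%:Z) ^+ 2)%:P * W m.
  rewrite {1}/W; have -> : (2 * m.+1 = (2 * m).+2)%N by lia.
  rewrite big_ord_recr big_ord_recl /=.
  have -> : 2 * (0%:Z - m.+1%:Z) = - (2 * m.+1%:Z) by lia.
  have -> : 2 * ((2 * m).+2%:Z - m.+1%:Z) = 2 * m.+1%:Z by lia.
  rewrite (eq_bigr (fun i : 'I_(2 * m).+1 => 'X - (qnum (2 * (i%:Z - m%:Z)))%:P)).
    rewrite -/(W m) qnumN polyCN; ring.
  by move=> i _; rewrite /bump /=; congr (_ - (qnum _)%:P); lia.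
rewrite !tprodW WS rmorphB [X in _ - X = _]rmorphM /= horner_algC mulr_algl.
by rewrite !rmorphM /= !horner_algX.
Qed.

(** Applying t twice to t^(2m+1) gives [2m+2][2m+3] t^(2m+3) + [2m+2]^2 t^(2m+1), and the square
    subtracted in [tprodS] removes the last term. *)
Lemma tprod_odd_normal m : (2 * m + 2 <= L)%N -> (m < M)%N ->
  (qnum_fact (2 * m).+1)^-1 *: tprod m = normal_sum (gcoef 1 m.+1).
Proof.
elim: m => [|m IH] mL mM.
  have := @tgenk_even 0 mL mM.
  rewrite normal_sum_gcoef00 // ?mulr1; last by lia.
  rewrite qnum0 scale0r addr0 add0r /qnum divff ?subqV_neq0 // scale1r => <-.
  rewrite /tprod /qnum_fact !big_ord1 /= subrr mulr0 qnum0 scale0r subr0.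
  by rewrite /qnum divff ?subqV_neq0 // invr1 scale1r.
have {}IH : tprod m = qnum_fact (2 * m).+1 *: normal_sum (gcoef 1 m.+1).
  by rewrite -IH ?scalerA ?divff ?qnum_fact_neq0 ?scale1r //; lia.
rewrite tprodS IH -!scalerAr tgenk_odd; try lia.
rewrite -!scalerAr tgenk_even; try lia.
have -> : (2 * m.+1).+1 = (2 * m).+3 by lia.
rewrite 2!(qnum_factS _.+1).
have -> : (2 * m).+2%:Z = 2 * m.+1%:Z by lia.
have -> : (2 * m).+3%:Z = 2 * m.+1%:Z + 1 by lia.
have -> : m.+1%:Z + 1 = m.+2%:Z by lia.
have n1 : qnum (2 * m.+1%:Z) != 0 by rewrite -PoszM qnum_neq0.
have n2 : qnum (2 * m.+1%:Z + 1) != 0 by rewrite -PoszM -PoszD qnum_neq0 // addn1.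
have n3 := qnum_fact_neq0 (2 * m).+1.
move: n1 n2 n3; set x := qnum (_ + 1); set y := qnum _; set f := qnum_fact _ => n1 n2 n3.
rewrite !(scalerDr, scalerN, scalerA) -addrA -scalerBl.
have -> : (f * y * x)^-1 * (f * y) * x = 1 by field; apply/and3P.
have -> : (f * y * x)^-1 * (f * y) * y - (f * y * x)^-1 * (y ^+ 2 * f) = 0 by ring.
by rewrite scale1r scale0r addr0.
Qed.

Lemma tprod_even_normal m : (2 * m + 2 < L)%N -> (m.+1 < M)%N ->
  (qnum_fact (2 * m.+1))^-1 *: (tgenk * tprod m) = normal_sum (gcoef 0 m.+1).
Proof.
move=> mL mM.
have -> : tprod m = qnum_fact (2 * m).+1 *: normal_sum (gcoef 1 m.+1).
  by rewrite -tprod_odd_normal ?scalerA ?divff ?qnum_fact_neq0 ?scale1r //; lia.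
rewrite -scalerAr tgenk_odd; try lia.
have -> : (2 * m.+1 = (2 * m).+2)%N by lia.
rewrite qnum_factS !scalerA; have -> : (2 * m).+2%:Z = 2 * m.+1%:Z by lia.
by rewrite -mulrA mulVf ?scale1r // mulf_neq0 ?qnum_fact_neq0 // -PoszM qnum_neq0.
Qed.

(** Reindexing by b = a + r: X vanishes on the part of the square outside the triangle a + r < n. *)
Lemma sum_triangle (V : zmodType) (n : nat) (X : nat -> nat -> V) :
    (forall a r, (n <= a + r)%N -> X a r = 0) ->
  \sum_(a < n) \sum_(r < n) X a r = \sum_(b < n) \sum_(a < b.+1) X a (b - a)%N.
Proof.
move=> X0; symmetry.
under eq_bigr => b _ do
  rewrite (big_ord_widen _ (fun a => X a (b - a)%N) (ltn_ord b)).
rewrite (exchange_big_dep xpredT) //=; apply: eq_bigr => a _.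
rewrite (eq_bigl (fun b : 'I_n => true && (a <= b)%N)) //.
rewrite -(big_geq_mkord _ _ xpredT (fun b => X a (b - a)%N)).
rewrite -{1}[nat_of_ord a]add0n big_addn big_mkord.
transitivity (\sum_(r < n - a) X a r).
  by apply: eq_bigr => r _; rewrite addnK.
rewrite (big_ord_widen n (X a) (leq_subr a n)) big_mkcond /=.
apply: eq_bigr => r _; case: ifP => // /negbT ra; rewrite X0 //; lia.
Qed.

Lemma gcoef_term (e : nat) (m : int) (a r : nat) :
  Ddiv a * ev (gcoef e m a r) * Fdiv r = \sum_(c < M)
    (q ^ ('C(2 * c, 2)%:Z + 2 * e%:Z * c%:Z
          - (a%:Z + r%:Z) * (2 * m - e%:Z - (a%:Z + r%:Z) - 2 * c%:Z) - a%:Z * r%:Z)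
      * pd (2 * m - e%:Z - (a%:Z + r%:Z) - 2 * c%:Z))
    *: (Ddiv a * ev (hpol q (1 - m) c)
        * k ^+ absz (2 * m - e%:Z - (a%:Z + r%:Z) - 2 * c%:Z)%R * Fdiv r).
Proof.
rewrite /gcoef /g /gpol scaler_sumr /ev rmorph_sum mulr_sumr mulr_suml.
apply: eq_bigr => c _ /=; rewrite -/(ev _).
set n := 2 * m - e%:Z - _ - _.
have -> : q ^ (- (a%:Z * r%:Z)) *:
    (qpow q ('C(2 * c, 2)%:Z + 2 * e%:Z * c%:Z - (a%:Z + r%:Z) * n)
      * (mon pd n * hpol q (1 - m) c))
    = (q ^ ('C(2 * c, 2)%:Z + 2 * e%:Z * c%:Z - (a%:Z + r%:Z) * n - a%:Z * r%:Z) * pd n)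
      *: (hpol q (1 - m) c * 'X^`|n|).
  rewrite /qpow mul_polyC /mon -scalerAl !scalerA [hpol _ _ _ * _]mulrC.
  by rewrite [X in _ = (X * _) *: _]expfzDr // [X in _ = (X * _) *: _]mulrC.
rewrite evZ evM; have -> : ev 'X^`|n| = k ^+ `|n| by rewrite /ev rmorphXn /= horner_algX.
move: (Ddiv a) (Fdiv r) => d f.
by rewrite -scalerAr -scalerAl !mulrA.
Qed.

Lemma normal_sum_gcoef (e : nat) (m : int) : 2 * m - e%:Z < L%:Z ->
  normal_sum (gcoef e m) =
    \sum_(b < L) \sum_(a < b.+1) \sum_(c < M)
      (q ^ ('C(2 * c, 2)%:Z + 2 * e%:Z * c%:Z
            - b%:Z * (2 * m - e%:Z - b%:Z - 2 * c%:Z) - a%:Z * (b%:Z - a%:Z))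
        * pd (2 * m - e%:Z - b%:Z - 2 * c%:Z))
      *: (Ddiv a * ev (hpol q (1 - m) c)
          * k ^+ absz (2 * m - e%:Z - b%:Z - 2 * c%:Z)%R * Fdiv (b - a)).
Proof.
move=> mL; rewrite /normal_sum.
rewrite (sum_triangle (X := fun a r => Ddiv a * ev (gcoef e m a r) * Fdiv r)); last first.
  by move=> a r ar; rewrite gcoef_eq0 /ev ?rmorph0 ?mulr0 ?mul0r //; lia.
apply: eq_bigr => b _; apply: eq_bigr => a _; rewrite gcoef_term.
have ab : (a <= b)%N by rewrite -ltnS.
have -> : a%:Z + (b - a)%N%:Z = b%:Z by lia.
by have -> : (b - a)%N%:Z = b%:Z - a%:Z by lia.
Qed.

End NormalOrder.

(** * Specialization to Q(q) and the recursion of the divided p_n *)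

Lemma q_neq0 : q != 0.
Proof. by rewrite /q tofrac_eq0 polyX_eq0. Qed.

Lemma q_not_root1 (n : nat) : (0 < n)%N -> q ^+ n != 1.
Proof.
move=> n0; rewrite /q -tofracXn -tofrac1 tofrac_eq.
apply: contraTneq n0 => /(congr1 (fun p : {poly rat} => size p)).
by rewrite size_polyXn size_poly1 => -[->].
Qed.

Lemma pnSS (n : nat) : pn n.+2 =
  'X * pn n.+1 + (q ^ (1 - 2 * (n.+1)%:Z) * qint (n.+1)%:Z * qint n%:Z) *: pn n.
Proof. by rewrite /pn /=; case: (ppair n). Qed.

Lemma pn1 : pn 1 = 'X. Proof. by []. Qed.

(** To be read with w = q - q^-1, f = [n]!, y_i = [n+i], P_i = p_(n+i)(x) and z the power of q in
    the recursion of p_(n+2). *)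
Lemma divided_recurrence (K : fieldType) (w x y0 y1 y2 f z P0 P1 : K) :
    f != 0 -> y1 != 0 -> y2 != 0 ->
  w * y2 * ((f * y1 * y2)^-1 * (x * P1 + z * y1 * y0 * P0))
  = w * x * ((f * y1)^-1 * P1) + z * (w * y0) * (f^-1 * P0).
Proof. by move=> *; field; apply/and3P. Qed.

Lemma p_div_neg (n : int) (x : Qq) : n < 0 -> (p_div n).[x] = 0.
Proof. by case: n => // n _; exact: horner0. Qed.

Lemma p_div_nat (n : nat) (x : Qq) : (p_div n).[x] = (qfact n)^-1 * (pn n).[x].
Proof. exact: hornerZ. Qed.

Lemma pnSS_horner (n : nat) (x : Qq) : (pn n.+2).[x] =
  x * (pn n.+1).[x] + q ^ (1 - 2 * (n.+1)%:Z) * qint (n.+1)%:Z * qint n%:Z * (pn n).[x].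
Proof. by rewrite pnSS hornerD hornerM hornerX hornerZ. Qed.

Lemma qfact0 : qfact 0 = 1. Proof. exact: big_ord0. Qed.

Lemma qfactS (n : nat) : qfact n.+1 = qfact n * qint n.+1.
Proof. exact: qnum_factS. Qed.

Lemma qint_neq0 (n : nat) : (0 < n)%N -> qint n != 0.
Proof. exact: (qnum_neq0 q_neq0 q_not_root1). Qed.

Lemma qfact_neq0 (n : nat) : qfact n != 0.
Proof. exact: (qnum_fact_neq0 q_neq0 q_not_root1). Qed.

Lemma qintE x : q ^ x - q ^ (- x) = (q - q^-1) * qint x.
Proof. by rewrite -(qnumE q_neq0 q_not_root1). Qed.

Lemma p_div0 (x : Qq) : (p_div 0).[x] = 1.
Proof. by rewrite p_div_nat qfact0 invr1 mul1r hornerC. Qed.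

Lemma p_div_rec (kappa : Qq) (n : int) :
  (q ^ n - q ^ (- n)) * (p_div n).[kappa]
  = (q - q^-1) * kappa * (p_div (n - 1)).[kappa]
    + q ^ (3 - 2 * n) * (q ^ (n - 2) - q ^ (2 - n)) * (p_div (n - 2)).[kappa].
Proof.
have -> : 2 - n = - (n - 2) by lia.
(* The defining recursion covers indices from 2 on; 0, 1 and negative indices are checked directly,
   using p^(n) = 0 for n < 0. *)
case: n => [[|[|n]]|n].
- by rewrite oppr0 subrr mul0r !(@p_div_neg (0 - _)) // !mulr0 addr0.
- rewrite (@p_div_neg (1 - 2)) // mulr0 addr0 subrr p_div0 mulr1 [in LHS]qintE.
  rewrite p_div_nat pn1 hornerX qfactS qfact0 mul1r.
  by rewrite mulrA (mulfK (@qint_neq0 1 isT)).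
- have -> : n.+2%:Z - 1 = n.+1 by lia.
  have -> : n.+2%:Z - 2 = n by lia.
  have -> : 3 - 2 * n.+2%:Z = 1 - 2 * n.+1%:Z by lia.
  rewrite !qintE !p_div_nat pnSS_horner !qfactS.
  by apply: divided_recurrence; rewrite ?qfact_neq0 ?qint_neq0.
- have neg : Negz n < 0 by [].
  by rewrite !p_div_neg ?mulr0 ?addr0 //; lia.
Qed.

Lemma Kpow_opp (A : algType Qq) (K Ki : A) (n : nat) : Kpow K Ki (- n%:Z) = Ki ^+ n.
Proof. by case: n. Qed.

Lemma horner_hpol (A : algType Qq) (Ki : A) (a : int) (c : nat) :
  horner_alg Ki (hpol q a c) = hbin Ki a c.
Proof.
rewrite /hpol rmorph_prod; apply: eq_bigr => i _ /=.
by rewrite horner_algZ rmorphB /= horner_algZ rmorphXn /= horner_algX rmorph1.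
Qed.

(** * Reordering rules for E-check, F and K^-1 from the relations of U *)

Section Uq.
Set Implicit Arguments. Unset Strict Implicit. Unset Printing Implicit Defensive.
Variables (A : algType Qq) (E F K Ki : A).
Hypothesis hKKi : K * Ki = 1.
Hypothesis hKiK : Ki * K = 1.
Hypothesis hEF : E * F - F * E = (q - q^-1)^-1 *: (K - Ki).
Hypothesis hKE : K * E = q ^+ 2 *: (E * K).
Hypothesis hKF : K * F = q ^- 2 *: (F * K).

Lemma Ki_E : Ki * E = q ^- 2 *: (E * Ki).
Proof.
have -> : E * Ki = Ki * (K * E) * Ki by rewrite mulrA hKiK mul1r.
rewrite hKE -scalerAr -scalerAl scalerA mulVf ?scale1r ?expf_neq0 ?q_neq0 //.
by rewrite -!mulrA hKKi mulr1.
Qed.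

Lemma F_Ki : F * Ki = q ^- 2 *: (Ki * F).
Proof.
have -> : F * Ki = Ki * (K * F) * Ki by rewrite mulrA hKiK mul1r.
by rewrite hKF -scalerAr -scalerAl -!mulrA hKKi mulr1.
Qed.

Lemma Ki_Echeck : Ki * Echeck E Ki = q ^ (- 2) *: (Echeck E Ki * Ki).
Proof.
by rewrite /Echeck -scalerAr mulrA Ki_E -!scalerAl !scalerA mulrC.
Qed.

(** Multiplying the commutator relation by q^-1 K^-1 on the right turns K - K^-1 into 1 - K^-2, and
    q^-1 / (q - q^-1) = 1 / (q^2 - 1). *)
Lemma F_Echeck : F * Echeck E Ki =
  q ^ (- 2) *: (Echeck E Ki * F) + (q ^+ 2 - 1)^-1 *: (Ki ^+ 2 - 1).
Proof.
have FE : F * E = E * F - (q - q^-1)^-1 *: (K - Ki) by rewrite -hEF opprB addrC subrK.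
have q2 : (q ^+ 2 - 1)^-1 = q^-1 * (q - q^-1)^-1.
  by rewrite -invfM mulrBr divff ?q_neq0 // expr2.
rewrite /Echeck -scalerAr mulrA FE mulrBl -[E * F * Ki]mulrA F_Ki.
rewrite -scalerAl mulrBl hKKi -expr2 scalerBr -!scalerAl -scalerAr.
rewrite !scalerA q2 mulrC -mulrA; congr (_ + _).
by rewrite -scalerN opprB.
Qed.

End Uq.

Theorem theorem2p8 (A : algType Qq) (E F K Ki : A) (l : int) (m : nat)
  (hKKi : K * Ki = 1) (hKiK : Ki * K = 1)
  (hEF : E * F - F * E = (q - q^-1)^-1 *: (K - Ki))
  (hKE : K * E = q ^+ 2 *: (E * K))
  (hKF : K * F = q ^- 2 *: (F * K))
  (hm : (1 <= m)%N) :
  let kappa := qint (2 * l) in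
  tdot_even E F Ki kappa m =
    \sum_(b < (2 * m).+1) \sum_(a < b.+1) \sum_(c < (2 * m).+1)
      (q ^ ('C(2 * c, 2)%:Z - b%:Z * (2 * m%:Z - b%:Z - 2 * c%:Z)
                - a%:Z * (b%:Z - a%:Z))
        * (p_div (2 * m%:Z - b%:Z - 2 * c%:Z)%R).[kappa])
      *: (Echeck_div E Ki a * hbin Ki (1 - m%:Z)%R c
          * Kpow K Ki (b%:Z - 2 * m%:Z + 2 * c%:Z)%R * F_div F (b - a))
  /\
  tdot_odd E F Ki kappa m.-1 =
    \sum_(b < (2 * m).-1.+1) \sum_(a < b.+1) \sum_(c < (2 * m).+1)
      (q ^ ('C(2 * c, 2)%:Z + 2 * c%:Z
                - b%:Z * (2 * m%:Z - b%:Z - 2 * c%:Z - 1)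
                - a%:Z * (b%:Z - a%:Z))
        * (p_div (2 * m%:Z - b%:Z - 2 * c%:Z - 1)%R).[kappa])
      *: (Echeck_div E Ki a * hbin Ki (1 - m%:Z)%R c
          * Kpow K Ki (b%:Z - 2 * m%:Z + 2 * c%:Z + 1)%R * F_div F (b - a)).
Proof.
move=> kappa; case: m hm => // m _.
have pd_neg n : n < 0 -> (p_div n).[kappa] = 0 by exact: p_div_neg.
have pd0 := p_div0 kappa.
have kD := Ki_Echeck hKKi hKiK hKE.
have Fk := F_Ki hKKi hKiK hKF.
have FD := F_Echeck hKKi hKiK hEF hKF.
have pd_rec := p_div_rec kappa.
(* Terms with n < 0 are zero on both sides, and for n >= 0 the power K^(-n) is the n-th power of
   [Ki]. *)
have termE (x y n z : int) (c a r : nat) : x = y -> z = - n ->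
    (q ^ x * (p_div n).[kappa]) *: (Ddiv q (Echeck E Ki) a
      * horner_alg Ki (hpol q (1 - m.+1%:Z) c) * Ki ^+ `|n| * Fdiv q F r)
    = (q ^ y * (p_div n).[kappa]) *: (Echeck_div E Ki a * hbin Ki (1 - m.+1%:Z) c
      * Kpow K Ki z * F_div F r).
  move=> -> ->; case: (ltP n 0) => [/pd_neg ->|n0]; first by rewrite mulr0 !scale0r.
  have -> : Kpow K Ki (- n) = Ki ^+ `|n| by rewrite -[in LHS](gez0_abs n0) Kpow_opp.
  by rewrite horner_hpol.
have q0 := q_neq0; have q1 := q_not_root1.
have todd M L := tprod_odd_normal q0 q1 kD Fk FD (L := L) pd_neg pd_rec pd0 (M := M).
have teven M L := tprod_even_normal q0 q1 kD Fk FD (L := L) pd_neg pd_rec pd0 (M := M).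
have sumE M L := normal_sum_gcoef q0 (Echeck E Ki) F Ki (L := L) pd_neg M.
split.
(* The m of the statement is now m + 1, so its even product has 2m + 1 factors with shifts
   [2(i - m)], which is [tprod] at m. *)
- transitivity ((qnum_fact q (2 * m.+1))^-1 *:
      (tgenk kappa (Echeck E Ki) F Ki * tprod q kappa (Echeck E Ki) F Ki m)).
    rewrite /tdot_even; congr (_ *: (_ * _)).
    have -> : ((2 * m.+1).-1 = (2 * m).+1)%N by lia.
    apply: eq_bigr => i _; rewrite -[qint _]/(qnum q _).
    by congr (_ - qnum q _ *: 1); lia.
  rewrite (teven (2 * m.+1).+1 (2 * m.+1).+1); try lia.
  rewrite sumE; last by lia.
  apply: eq_bigr => b _; apply: eq_bigr => a _; apply: eq_bigr => c _.
  have -> : 2 * m.+1%:Z - b%:Z - 2 * c%:Z = 2 * m.+1%:Z - 0%:Z - b%:Z - 2 * c%:Z by lia.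
  by apply: termE; lia.
- transitivity ((qnum_fact q (2 * m).+1)^-1 *: tprod q kappa (Echeck E Ki) F Ki m) => //.
  (* The truncations are the ranges in the statement: the first argument bounds c and the second
     bounds b. *)
  rewrite (todd (2 * m.+1).+1 (2 * m.+1).-1.+1); try lia.
  rewrite sumE; last by lia.
  apply: eq_bigr => b _; apply: eq_bigr => a _; apply: eq_bigr => c _.
  have -> : 2 * m.+1%:Z - b%:Z - 2 * c%:Z - 1 = 2 * m.+1%:Z - 1%:Z - b%:Z - 2 * c%:Z by lia.
  by apply: termE; lia.
Qed.
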